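(* Let $X$ be a real Banach space. (1) Let $u,v\in S_X$ with $u\neq -v$, and put $x=\frac{u+v}{2}$, $z=\frac{u-v}{2}$. Choose $f\in J(x)$ and define $\beta=f(z)/\|x\|$ and $y=z-\beta x$. Then $x\perp_B y$, and $$u=(1+\beta)x+y,\qquad v=(1-\beta)x-y.$$ In particular, $\|(1+\beta)x+y\|=\|(1-\beta)x-y\|=1$. (2) Conversely, if $x,y\in X$, $x\neq0$, $x\perp_B y$, $\beta\in\mathbb{R}$ and $$\|(1+\beta)x+y\|=\|(1-\beta)x-y\|=r>0,$$ then $$u=\frac{(1+\beta)x+y}{r},\qquad v=\frac{(1-\beta)x-y}{r}$$ are points of $S_X$ and $$\frac{u+v}{2}=\frac{x}{r},\qquad \frac{u-v}{2}=\frac{\beta x+y}{r}.$$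
   Context: $S_X=\{x\in X:\|x\|=1\}$. Birkhoff-James orthogonality: $x\perp_B y$ means $\|x+ty\|\ge\|x\|$ for all $t\in\mathbb{R}$. For $x\neq0$, $J(x)=\{f\in X^*:\|f\|=1,\ f(x)=\|x\|\}$, which is non-empty by the Hahn–Banach theorem. *)

(* Defs.v *)
From HB Require Import structures.
From mathcomp Require Import all_boot all_order all_algebra.
From mathcomp Require Import classical_sets reals topology normedtype.

Set Implicit Arguments.
Unset Strict Implicit.
Unset Printing Implicit Defensive.

Import Order.TTheory GRing.Theory Num.Theory.
Import numFieldNormedType.Exports.

Local Open Scope classical_set_scope.
Local Open Scope ring_scope.

Definition unit_sphere (R : realType) (X : normedModType R) : set X :=
  [set x | `|x| = 1].
Arguments unit_sphere {R} X.

Definition bj_orthogonal (R : realType) (X : normedModType R) (x y : X) : Prop :=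
  forall t : R, `|x| <= `|x + t *: y|.

(* The real-valued [sup] is the operator norm only for bounded functionals: on
   an unbounded one it takes a default value. *)
Definition dual_norm (R : realType) (X : normedModType R)
    (f : {linear X -> R^o}) : R :=
  sup [set `|f w| | w in [set w : X | `|w| <= 1]].

(* The dual X^* is the set of continuous elements of {linear X -> R^o}; the
   continuity clause is what makes [dual_norm f] meaningful. The set is intended
   for x != 0. *)
Definition norming_functionals (R : realType) (X : normedModType R) (x : X) :
    set {linear X -> R^o} :=
  [set f : {linear X -> R^o} | [/\ continuous f, dual_norm f = 1 & f x = `|x|] ].

(* Main.v *)
(* A functional of dual norm 1 satisfies [|f w| <= |w|]; as [f] kills [y] and
   attains the norm of [x], [|x| = f (x + t y) <= |x + t y|]. Everything else is
   linear algebra. *)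

Require Import Defs.
From mathcomp Require Import all_boot all_order all_algebra.
From mathcomp Require Import boolp classical_sets reals topology normedtype.

Set Implicit Arguments.
Unset Strict Implicit.
Unset Printing Implicit Defensive.

Import Order.TTheory GRing.Theory Num.Theory.
Import numFieldNormedType.Exports.

Local Open Scope classical_set_scope.
Local Open Scope ring_scope.

(** In both parts the two vectors are [x + z] and [x - z] with [z = beta *: x + y], up to the factor
    [r^-1] in the converse, so their half-sum and half-difference recover [x] and [z]. The analytic
    content is orthogonality: [beta] is chosen so that [f y = f z - beta * f x = 0], and
    [bj_orthogonal_ker] turns this into [bj_orthogonal x y]. *)

(* [sup] is [0] on a set without supremum, so norm [1] already forces boundedness. *)
Lemma norm_le_dual_norm1 (R : realType) (X : normedModType R)
    (f : {linear X -> R^o}) (w : X) :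
  dual_norm f = 1 -> `|f w| <= `|w|.
Proof.
rewrite /dual_norm => f1.
have [->|w0] := eqVneq w 0; first by rewrite linear0 !normr0.
have nw0 : 0 < `|w| by rewrite normr_gt0.
have hs : has_sup [set `|f w| | w in [set w : X | `|w| <= 1]].
  apply: contrapT => /sup_out f0.
  by move: f1; rewrite f0 => /esym/eqP; rewrite oner_eq0.
(* Normalizing [w] puts it in the unit ball, where the supremum bounds [f]; homogeneity then scales
   the bound back. *)
have : `|f (`|w|^-1 *: w)| <= 1.
  rewrite -f1; apply: ub_le_sup; first by case: hs.
  by exists (`|w|^-1 *: w) => //=; rewrite normrZ normfV normr_id mulVf ?gt_eqF.
by rewrite linearZ normrM normfV normr_id mulrC ler_pdivrMr // mul1r.
Qed.

(** Along the line [x + t *: y] the functional keeps the constant value [|x|], which cannot exceed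
    the norm of any point of that line. *)
Lemma bj_orthogonal_ker (R : realType) (X : normedModType R)
    (f : {linear X -> R^o}) (x y : X) :
  norming_functionals x f -> f y = 0 -> bj_orthogonal x y.
Proof.
move=> [_ f1 fx] fy t.
apply: le_trans (norm_le_dual_norm1 (x + t *: y) f1).
by rewrite linearD linearZ fx fy /= scaler0 addr0 normr_id.
Qed.

Lemma half_add_self (R : numFieldType) (V : lmodType R) (p : V) :
  2^-1 *: (p + p) = p.
Proof. by rewrite -mulr2n -[p *+ 2]scaler_nat scalerA mulVf ?scale1r ?pnatr_eq0. Qed.

Lemma half_addDB (R : numFieldType) (V : lmodType R) (p q : V) :
  2^-1 *: ((p + q) + (p - q)) = p.
Proof. by rewrite addrACA subrr addr0 half_add_self. Qed.

Lemma half_subDB (R : numFieldType) (V : lmodType R) (p q : V) :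
  2^-1 *: ((p + q) - (p - q)) = q.
Proof. by rewrite opprB [p + q]addrC addrA addrAC addrK half_add_self. Qed.

Theorem lemma4p4 (R : realType) (X : completeNormedModType R) :
  (forall u v : X,
      unit_sphere X u -> unit_sphere X v -> u != - v ->
      let x : X := 2^-1 *: (u + v) in
      let z : X := 2^-1 *: (u - v) in
      forall f : {linear X -> R^o}, norming_functionals x f ->
      let beta : R := f z / `|x| in
      let y : X := z - beta *: x in
      [/\ bj_orthogonal x y,
          u = (1 + beta) *: x + y,
          v = (1 - beta) *: x - y,
          `|(1 + beta) *: x + y| = 1
        & `|(1 - beta) *: x - y| = 1])
  /\
  (forall (x y : X) (beta r : R),
      x != 0 -> bj_orthogonal x y ->
      `|(1 + beta) *: x + y| = r -> `|(1 - beta) *: x - y| = r -> 0 < r ->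
      let u : X := r^-1 *: ((1 + beta) *: x + y) in
      let v : X := r^-1 *: ((1 - beta) *: x - y) in
      [/\ unit_sphere X u,
          unit_sphere X v,
          2^-1 *: (u + v) = r^-1 *: x
        & 2^-1 *: (u - v) = r^-1 *: (beta *: x + y)]).
Proof.
(* Regrouping around [b *: x + y] serves both parts: it equals [z] in the first and is the
   half-difference before scaling in the second. *)
have addE (b : R) (x y : X) : (1 + b) *: x + y = x + (b *: x + y).
  by rewrite scalerDl scale1r addrA.
have subE (b : R) (x y : X) : (1 - b) *: x - y = x - (b *: x + y).
  by rewrite scalerBl scale1r opprD addrA.
split=> [u v u1 v1 uv x z f fJ beta y|x y beta r x0 xy ur vr r0 u v].
- have x0 : x != 0.
    by rewrite scaler_eq0 invr_eq0 pnatr_eq0 /= addr_eq0.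
  have bxy : beta *: x + y = z by rewrite addrC subrK.
  have eu : u = (1 + beta) *: x + y.
    by rewrite addE bxy -scalerDr addrACA subrr addr0 half_add_self.
  have ev : v = (1 - beta) *: x - y.
    by rewrite subE bxy -scalerBr half_subDB.
  split; rewrite -?eu -?ev //.
  apply: (bj_orthogonal_ker fJ); case: fJ => _ _ fx.
  (* Scaling in [R^o] is multiplication, so [beta *: f x] unfolds to [f z / |x| * |x|]; it cancels
     because [u != - v] makes [x] nonzero. *)
  rewrite linearB [f (beta *: x)]linearZ /= fx -[_ *: _]/(_ * _) divfK ?subrr //.
  by rewrite normr_eq0.
- have sphere w : `|w| = r -> unit_sphere X (r^-1 *: w).
    move=> wr.
    by rewrite /unit_sphere /= normrZ wr normfV gtr0_norm // mulVf ?gt_eqF.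
  split; [exact: sphere | exact: sphere | |].
  (* The factors [2^-1] and [r^-1] are swapped so that halving acts on the unscaled vectors. *)
  + by rewrite -scalerDr scalerA mulrC -scalerA addE subE half_addDB.
  + by rewrite -scalerBr scalerA mulrC -scalerA addE subE half_subDB.
Qed.
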